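(* Suppose that the partial-label learning problem given by the joint law $p(\boldsymbol{x},y,s)$ is proper, i.e. there exists a function $C:\mathcal{X}\times\mathcal{S}\to\mathbb{R}$ such that $p(s|\boldsymbol{x},y)=C(\boldsymbol{x},s)\,\boldsymbol{1}\{y\in s\}$. Then, for every classifier $f:\mathcal{X}\to\mathbb{R}^K$ and loss function $\mathcal{L}$, the classification risk $R(f;\mathcal{L})=\mathbb{E}_{p(\boldsymbol{x},y)}[\mathcal{L}(f(\boldsymbol{x}),y)]$ can be expressed as $$R(f;\mathcal{L})=\mathbb{E}_{p(\boldsymbol{x},s)}\left[\sum_{j\in s}\frac{p(y=j|\boldsymbol{x})}{\sum_{k\in s}p(y=k|\boldsymbol{x})}\,\mathcal{L}(f(\boldsymbol{x}),j)\right].$$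
   Context: Setting: $\mathcal{X}\subseteq\mathbb{R}^d$ is the instance space, $\mathcal{Y}=\{1,\dots,K\}$ with $K>2$ is the label space, and $\mathcal{S}=2^{\mathcal{Y}}\setminus\{\emptyset,\mathcal{Y}\}$ is the space of partial labels (candidate label sets). The random triple $(\boldsymbol{x},y,s)\in\mathcal{X}\times\mathcal{Y}\times\mathcal{S}$ has joint density $p(\boldsymbol{x},y,s)$ (with respect to Lebesgue measure in $\boldsymbol{x}$ and counting measure in $y,s$); $p(\boldsymbol{x},y)$, $p(\boldsymbol{x},s)$, $p(s|\boldsymbol{x},y)$, $p(y|\boldsymbol{x})$ etc. are the corresponding marginals and conditionals. Identities between conditional densities are understood for (almost) all values at which the conditioning density is positive. Standing assumption of partial-label learning: $P(y\in s\,|\,\boldsymbol{x},s)=1$. A loss function is a map $\mathcal{L}:\mathbb{R}^K\times\mathcal{Y}\to\mathbb{R}$; functions are measurable and the risk is assumed to be well defined (the expectation exists). *)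

(* Defs.v *)
From HB Require Import structures.
From mathcomp Require Import all_boot all_order all_algebra.
From mathcomp Require Import all_classical all_reals all_analysis.

Set Implicit Arguments.
Unset Strict Implicit.
Unset Printing Implicit Defensive.

Import Order.TTheory GRing.Theory Num.Theory.
Import numFieldNormedType.Exports.

Local Open Scope classical_set_scope.
Local Open Scope ring_scope.

(** R^d is [d.-tuple R] with the Borel (product) sigma-algebra of the library.
    The library has no Lebesgue measure in dimension d; it is built below by
    iterating the product [lebesgue_measure \x _] and transporting the result
    along [(a, t) |-> a :: t]. *)
Section lebesgue_tuple.
Variable R : realType.

(* [lebesgue_measure] lives on [measurableTypeR R], which has the same carrier
   and the same measurable sets as [R] but another display. *)
Definition cons_pair n (z : measurableTypeR R * n.-tuple R) : n.+1.-tuple R :=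
  [tuple of (z.1 : R) :: z.2].

Lemma measurable_cons_pair n : measurable_fun setT (@cons_pair n).
Proof.
apply: measurable_cons measurable_snd.
by move=> mT Y mY; exact: (@measurable_fst _ _ (measurableTypeR R)).
Qed.

Definition uncons n (t : n.+1.-tuple R) : measurableTypeR R * n.-tuple R :=
  (thead t, [tuple of behead t]).

Lemma measurable_uncons n : measurable_fun setT (@uncons n).
Proof.
apply: measurable_fun_pair; last exact: measurable_behead.
by move=> mT Y mY; exact: (@measurable_tnth _ R n.+1 ord0).
Qed.

Lemma cons_pairK n : cancel (@cons_pair n) (@uncons n).
Proof.
by move=> [a t]; rewrite /uncons /cons_pair/= theadE; congr pair; exact: val_inj.
Qed.

Section step.
Variables (n : nat)
  (m : {sigma_finite_measure set (n.-tuple R) -> \bar R}).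

Definition lebesgue_cons : set (n.+1.-tuple R) -> \bar R :=
  pushforward (@lebesgue_measure R \x m)%E (@cons_pair n).

Let lebesgue_cons0 : lebesgue_cons set0 = 0%E.
Proof. by rewrite /lebesgue_cons /pushforward preimage_set0 measure0. Qed.

Let lebesgue_cons_ge0 A : (0 <= lebesgue_cons A)%E.
Proof. exact: (measure_ge0 (@lebesgue_measure R \x m)%E). Qed.

Let lebesgue_cons_sigma_additive : semi_sigma_additive lebesgue_cons.
Proof.
apply: (@measure_semi_sigma_additive _ _ _ (pushforward _ _)).
exact: measurable_cons_pair.
Qed.

HB.instance Definition _ := isMeasure.Build _ _ _ lebesgue_cons
  lebesgue_cons0 lebesgue_cons_ge0 lebesgue_cons_sigma_additive.

Let lebesgue_cons_sigma_finite : sigma_finite setT lebesgue_cons.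
Proof.
have /sigma_finiteP[F [TF ndF Foo]] := sigma_finiteT (@lebesgue_measure R).
have /sigma_finiteP[G [TG ndG Goo]] := sigma_finiteT m.
exists (fun k => @uncons n @^-1` (F k `*` G k)).
  rewrite predeqE => t; split => // _.
  have [i _ Fi] : (\bigcup_i F i) (uncons t).1 by rewrite -TF.
  have [j _ Gj] : (\bigcup_i G i) (uncons t).2 by rewrite -TG.
  exists (maxn i j) => //; split.
  - by move: Fi; exact/subsetPset/ndF/leq_maxl.
  - by move: Gj; exact/subsetPset/ndG/leq_maxr.
move=> k; have [[mF Fk] [mG Gk]] := (Foo k, Goo k); split.
  by rewrite -[X in measurable X]setTI; apply: measurable_uncons => //;
    exact: measurableX.
rewrite /lebesgue_cons /pushforward -comp_preimage.
rewrite [X in X @^-1` _](_ : _ = id) ?preimage_id; last first.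
  exact/funext/cons_pairK.
by rewrite product_measure1E// lte_mul_pinfty// ge0_fin_numE.
Qed.

HB.instance Definition _ :=
  @Measure_isSigmaFinite.Build _ _ _ lebesgue_cons lebesgue_cons_sigma_finite.

End step.

Fixpoint lebesgue_tuple (d : nat) :
    {sigma_finite_measure set (d.-tuple R) -> \bar R} :=
  if d is n.+1 then lebesgue_cons (lebesgue_tuple n)
  else \d_([tuple] : 0.-tuple R).

Lemma lebesgue_tuple_box d (A : 'I_d -> set R) :
  (forall i, measurable (A i)) ->
  lebesgue_tuple d [set t | forall i, A i (tnth t i)] =
  (\prod_(i < d) @lebesgue_measure R (A i))%E.
Proof.
elim: d A => [|d IH] A mA.
  rewrite big_ord0/= diracE mem_set// => -[].
  by [].
rewrite big_ord_recl -IH => [|i]; last exact: mA.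
rewrite /= /lebesgue_cons /pushforward -product_measure1E; first last.
- rewrite [X in measurable X](_ : _ = \big[setI/setT]_(i < d)
    ((fun t : d.-tuple R => tnth t i) @^-1` A (lift ord0 i))).
    apply: bigsetI_measurable => i _; rewrite -[X in measurable X]setTI.
    exact: measurable_tnth.
  apply/seteqP; split => [t At|t].
    by rewrite -bigcap_seq => i _; exact: At.
  by rewrite -bigcap_seq => At i; apply: (At i); rewrite /= mem_index_enum.
- exact: mA.
congr (_ _); apply/seteqP; split => -[a t] /=.
  move=> At; split; first exact: (At ord0).
  by move=> i; have := At (lift ord0 i); rewrite tnthS.
move=> [A0 At] i; case: (unliftP ord0 i) => [j ->|->//].
by rewrite tnthS; exact: At.
Qed.

End lebesgue_tuple.

(** The label space {1, ..., K} is ['I_K].  Since ['I_K] and [partial_label K]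
    are finite and carry the discrete sigma-algebra, measurability of a random
    label is stated on the preimages of points. *)
Definition partial_label (K : nat) :=
  {s : {set 'I_K} | (s != finset.set0) && (s != finset.setT)}.

HB.instance Definition _ K := Finite.on (partial_label K).

Section partial_label_learning.
Context {R : realType} {d K : nat}.

Definition pll_density := d.-tuple R -> 'I_K -> partial_label K -> R.

(** [p] is a joint density of the random triple (x, y, s), with values in
    X * Y * S, with respect to Lebesgue measure * counting * counting. *)
Record is_joint_density (X : set (d.-tuple R)) {disp : measure_display}
    {Omega : measurableType disp} (P : probability Omega R)
    (x : Omega -> d.-tuple R) (y : Omega -> 'I_K)
    (s : Omega -> partial_label K) (p : pll_density) : Prop := {
  measurable_instance : measurable_fun setT x ;
  measurable_label : forall j, measurable (y @^-1` [set j]) ;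
  measurable_partial_label : forall c, measurable (s @^-1` [set c]) ;
  instance_in_X : forall w, X (x w) ;
  measurable_density : forall j c, measurable_fun X (fun t => p t j c) ;
  density_ge0 : forall t j c, X t -> 0 <= p t j c ;
  density_law : forall (A : set (d.-tuple R)) j c, measurable A -> A `<=` X ->
    P [set w | [/\ A (x w), y w = j & s w = c]] =
    (\int[lebesgue_tuple R d]_(t in A) (p t j c)%:E)%E }.

Implicit Types (p : pll_density) (t : d.-tuple R) (j : 'I_K)
  (c : partial_label K).

Definition density_xy p t j : R := \sum_(c : partial_label K) p t j c.
Definition density_xs p t c : R := \sum_(j < K) p t j c.
Definition density_x p t : R := \sum_(j < K) density_xy p t j.

(** Conditional densities; they are 0 where the conditioning density is 0. *)
Definition cond_s_xy p c t j : R := p t j c / density_xy p t j.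
Definition cond_y_x p j t : R := density_xy p t j / density_x p t.
Definition cond_y_xs p j t c : R := p t j c / density_xs p t c.

(** P(y \in s | x, s) = 1, the conditional probability being the sum of
    p(y = j | x, s) over j \in s. *)
Definition candidate_contains_label (X : set (d.-tuple R)) p : Prop :=
  {ae lebesgue_tuple R d, forall t, X t ->
    forall c, 0 < density_xs p t c ->
      \sum_(j in sval c) cond_y_xs p j t c = 1}.

Definition proper_pll (X : set (d.-tuple R)) p : Prop :=
  exists C : d.-tuple R -> partial_label K -> R,
    {ae lebesgue_tuple R d, forall t, X t ->
      forall j c, 0 < density_xy p t j ->
        cond_s_xy p c t j = C t c * (j \in sval c)%:R}.

End partial_label_learning.

(** The expectation of [g] exists in the extended sense: [g] is measurable and
    its positive part or its negative part has finite expectation.  Where this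
    fails, ['E_P[g]] is a junk value. *)
Definition has_expectation {disp : measure_display}
    {Omega : measurableType disp} {R : realType} (P : probability Omega R)
    (g : Omega -> R) : Prop :=
  measurable_fun setT g /\
  ((\int[P]_w ((EFin \o g)^\+ w) < +oo)%E \/
   (\int[P]_w ((EFin \o g)^\- w) < +oo)%E).

(** E_{p(x,y)} is the expectation under [P] of a function of the random pair
    (x, y), and likewise E_{p(x,s)} for the random pair (x, s). *)
Definition classification_risk {R : realType} {d K : nat}
    {disp : measure_display} {Omega : measurableType disp}
    (P : probability Omega R) (x : Omega -> d.-tuple R) (y : Omega -> 'I_K)
    (f : d.-tuple R -> K.-tuple R) (L : K.-tuple R -> 'I_K -> R) : \bar R :=
  ('E_P[fun w => L (f (x w)) (y w)])%E.

Definition weighted_loss {R : realType} {d K : nat}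
    (p : @pll_density R d K) (f : d.-tuple R -> K.-tuple R)
    (L : K.-tuple R -> 'I_K -> R) (t : d.-tuple R) (c : partial_label K) : R :=
  \sum_(j in sval c)
    cond_y_x p j t / (\sum_(k in sval c) cond_y_x p k t) * L (f t) j.

(* Main.v *)
(** Properness means p(x, j, s) = C(x, s) 1{j \in s} p(x, j) for almost every x.
    Hence both sides of
      \sum_j p(x, j, s) L_j = p(x, s) W(x, s),
    with W the weighted loss, equal C(x, s) times the sum over j \in s of
    p(x, j) L_j, because p(x) cancels in the weights.  Integrating over x and
    summing over s gives the theorem for nonnegative losses.  A signed loss is
    split as L^+ - L^-; the positive and negative parts of W are then dominated
    by (not equal to) the weighted losses of L^+ and L^-, which is enough for
    the expectation of W to exist. *)
Require Import Defs.
From mathcomp Require Import all_boot all_order all_algebra.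
From mathcomp Require Import all_classical all_reals all_analysis.
From mathcomp Require Import measurable_realfun ring lra.
Local Open Scope classical_set_scope.
Local Open Scope ring_scope.
Import Order.TTheory GRing.Theory Num.Theory.
Import HBNNSimple.

(* x^-1 = x * (x^2)^-1, and powers with a fixed real exponent are measurable. *)
Lemma measurable_funV {d : measure_display} {T : measurableType d}
    {R : realType} (D : set T) (f : T -> R) :
  measurable_fun D f -> measurable_fun D (fun t => (f t)^-1).
Proof.
move=> mf.
rewrite [X in measurable_fun _ X](_ : _ = f \* (fun t => (f t ^+ 2) `^ (-1))).
  apply: measurable_funM => //.
  apply: (measurableT_comp (measurable_powR (-1))).
  exact: measurable_funX.
apply/funext => t /=; rewrite powR_inv1 ?sqr_ge0// expr2.
have [->|ft0] := eqVneq (f t) 0; first by rewrite invr0 mul0r.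
by rewrite invfM mulrA divff// mul1r.
Qed.

(** * Expectations computed through a density *)

(** Monotone convergence along [nnsfun_approx] reduces [g] to simple functions, whose level sets
    fall under the hypothesis on [nu]. The set [E] will be the event that the labels are j and c, on
    which [p ^~ j ^~ c] is the density of [x]. *)
Lemma ge0_integral_density {d1 d2 : measure_display} {T1 : measurableType d1}
    {T2 : measurableType d2} {R : realType}
    (nu : {measure set T1 -> \bar R}) (mu : {measure set T2 -> \bar R})
    (phi : T1 -> T2) (E : set T1) (X : set T2) (q g : T2 -> R) :
  measurable E -> measurable X -> measurable_fun E phi ->
  (forall w, E w -> X (phi w)) ->
  measurable_fun X q -> (forall t, X t -> 0 <= q t) ->
  (forall A, measurable A -> A `<=` X ->
    nu (E `&` phi @^-1` A) = (\int[mu]_(t in A) (q t)%:E)%E) ->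
  measurable_fun X g -> (forall t, X t -> 0 <= g t) ->
  (\int[nu]_(w in E) (g (phi w))%:E = \int[mu]_(t in X) (g t * q t)%:E)%E.
Proof.
move=> mE mX mphi EX mq q0 nuE mg g0.
have mEg : measurable_fun X (EFin \o g) by exact/measurable_EFinP.
have g0' t : X t -> (0 <= (EFin \o g) t)%E by move=> Xt; rewrite lee_fin g0.
pose h := nnsfun_approx mX mEg.
have hcvg t (Xt : X t) := cvg_nnsfun_approx mX mEg g0' Xt.
have hnd : nondecreasing_seq (h : (T2 -> R)^nat) by exact: nd_nnsfun_approx.
have mhphi n : measurable_fun E (h n \o phi).
  exact: (measurableT_comp (measurable_funP (h n))).
transitivity (limn (fun n => \int[nu]_(w in E) (h n (phi w))%:E)%E).
  rewrite -monotone_convergence//.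
  - by apply: eq_integral => w /[!inE] /EX/hcvg => /cvg_lim; rewrite -/h => ->.
  - by move=> n; exact/measurable_EFinP/mhphi.
  - by move=> n w _; rewrite lee_fin.
  - by move=> w _ m n mn; rewrite lee_fin; exact/lefP/hnd.
transitivity (limn (fun n => \int[mu]_(t in X) (h n t * q t)%:E)%E); last first.
  rewrite -monotone_convergence//.
  - apply: eq_integral => t /[!inE] /hcvg ht; apply/cvg_lim => //.
    by under eq_fun do rewrite EFinM; rewrite EFinM; exact: cvgeZr.
  - move=> n; apply/measurable_EFinP/measurable_funM => //.
    exact: measurable_funP.
  - by move=> n t Xt; rewrite lee_fin mulr_ge0 ?q0.
  - by move=> t Xt m n mn; rewrite lee_fin ler_wpM2r ?q0//; exact/lefP/hnd.
congr (limn _); apply/funext => n.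
have mh r : measurable (h n @^-1` [set r]).
  by rewrite -[X in measurable X]setTI; exact: (measurable_funP (h n)).
(* Both integrals of [h n] equal one finite sum over its values. The level sets are cut down to [X]
   because the hypothesis on [nu] only covers subsets of [X]. *)
transitivity (\sum_(r \in range (h n))
    r%:E * nu (E `&` phi @^-1` (X `&` h n @^-1` [set r])))%E.
  transitivity (\int[nu]_(w in E)
      \sum_(r \in range (h n)) (r * \1_(h n @^-1` [set r]) (phi w))%:E)%E.
    by apply: eq_integral => w _; rewrite /= {1}fimfunE fsumEFin.
  have mterm r : measurable_fun E
      (fun w => (\1_(h n @^-1` [set r]) (phi w) : R)).
    by apply: (measurableT_comp _ mphi); exact: measurable_indic.
  rewrite ge0_integral_fsum//; last 2 first.
  - by move=> r; apply/measurable_EFinP/measurable_funM.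
  - by move=> r w _; exact: nnfun_muleindic_ge0.
  apply: eq_fsbigr => r /[!inE] -[t _ rE].
  under eq_integral do rewrite EFinM.
  rewrite ge0_integralZl//; last 2 first.
  - exact/measurable_EFinP/mterm.
  - by rewrite lee_fin -rE.
  congr (_ * _)%E.
  have -> : E `&` phi @^-1` (X `&` h n @^-1` [set r]) =
      E `&` phi @^-1` (h n @^-1` [set r]).
    apply/seteqP; split=> w [Ew]; first by case.
    by move=> hw; do 2 split=> //; exact: EX.
  have mA : measurable (E `&` phi @^-1` (h n @^-1` [set r])) by exact: mphi.
  rewrite -[RHS](_ : nu ((E `&` phi @^-1` (h n @^-1` [set r])) `&` E) = _).
    rewrite -(integral_indic nu mE mA); apply: eq_integral => w Ew.
    by rewrite !indicE in_setI Ew.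
  by rewrite setIAC setIid.
under [RHS]eq_integral.
  move=> t /[!inE] Xt.
  rewrite {1}fimfunE EFinM -fsumEFin// muleC ge0_mule_fsumr; last first.
    by move=> r; exact: nnfun_muleindic_ge0.
  over.
rewrite ge0_integral_fsum//; last 2 first.
- move=> r; apply: emeasurable_funM; apply/measurable_EFinP => //.
  by apply: measurable_funM => //; exact: measurable_indic.
- by move=> r t Xt; rewrite mule_ge0 ?lee_fin ?q0//; exact: nnfun_muleindic_ge0.
apply: eq_fsbigr => r /[!inE] -[t _ rE].
have mXA : measurable (X `&` h n @^-1` [set r]) by exact: measurableI.
(* The mass of the level set becomes an integral of [q], and the level set then moves into the
   integrand as an indicator. *)
rewrite nuE// integral_mkcondr -ge0_integralZl//; last 3 first.
- apply/(measurable_restrict _ (mh r) mX).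
  by apply/measurable_EFinP; apply: measurable_funS mq.
- by move=> u Xu; rewrite patchE; case: ifPn => //; rewrite lee_fin q0.
- by rewrite lee_fin -rE.
apply: eq_integral => u Xu; rewrite epatch_indic/= -!EFinM.
by congr EFin; ring.
Qed.

(** * Fibres of finite-valued maps, and differences of nonnegative functions *)

Lemma bigsetU_fibers {T : Type} {I : finType} (u : T -> I) :
  \big[setU/set0]_(i : I) (u @^-1` [set i]) = setT.
Proof.
rewrite -bigcup_seq; apply/seteqP; split=> // w _.
by exists (u w) => //=; rewrite mem_index_enum.
Qed.

(** Cutting a preimage along the fibres of [u] leaves a finite union of measurable pieces, so no
    sigma-algebra on [I] enters. *)
Lemma measurable_fun_fibers {d1 d2 : measure_display} {T1 : measurableType d1}
    {T2 : measurableType d2} {I : finType} (u : T1 -> I) (g : I -> T1 -> T2) :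
  (forall i, measurable (u @^-1` [set i])) ->
  (forall i, measurable_fun (u @^-1` [set i]) (g i)) ->
  measurable_fun setT (fun w => g (u w) w).
Proof.
move=> mu mg _ A mA.
rewrite -(bigsetU_fibers u) big_distrl/=.
apply: bigsetU_measurable => i _.
rewrite [X in measurable X](_ : _ = u @^-1` [set i] `&` g i @^-1` A).
  exact: mg.
by apply/seteqP; split=> w /= [<-].
Qed.

Lemma ge0_integral_fibers {d : measure_display} {T : measurableType d}
    {R : realType} (m : {measure set T -> \bar R}) {I : finType} (u : T -> I)
    (g : I -> T -> \bar R) :
  (forall i, measurable (u @^-1` [set i])) ->
  (forall i, measurable_fun (u @^-1` [set i]) (g i)) ->
  (forall w, 0 <= g (u w) w)%E ->
  (\int[m]_w g (u w) w = \sum_i \int[m]_(w in u @^-1` [set i]) g i w)%E.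
Proof.
move=> mu mg g0.
rewrite -(bigsetU_fibers u) ge0_integral_bigsetU//.
- apply: eq_bigr => i _; apply: eq_integral => w.
  by rewrite inE/= => ->.
- exact: index_enum_uniq.
- apply/trivIsetP => i j _ _ ij; apply/seteqP; split=> // w /= [-> /eqP].
  by rewrite (negbTE ij).
- by rewrite bigsetU_fibers; exact: measurable_fun_fibers.
Qed.

(** Since [a] and [b] may be positive at the same point, they only dominate the positive and
    negative parts of g = a - b. The pointwise identity g^+ + b = g^- + a, free of subtraction, is
    integrated and then rearranged. *)
Lemma integral_ge0B {d : measure_display} {T : measurableType d} {R : realType}
    (P : probability T R) (a b : T -> R) :
  measurable_fun setT a -> measurable_fun setT b ->
  (forall w, 0 <= a w) -> (forall w, 0 <= b w) ->
  (\int[P]_w (a w)%:E < +oo \/ \int[P]_w (b w)%:E < +oo)%E ->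
  has_expectation P (fun w => a w - b w) /\
  (\int[P]_w (a w - b w)%:E = \int[P]_w (a w)%:E - \int[P]_w (b w)%:E)%E.
Proof.
move=> ma mb a0 b0 ab.
have mg : measurable_fun setT (fun w => a w - b w) by exact: measurable_funB.
have mEa : measurable_fun setT (EFin \o a) by exact/measurable_EFinP.
have mEb : measurable_fun setT (EFin \o b) by exact/measurable_EFinP.
set g := EFin \o (fun w => a w - b w).
have mg' : measurable_fun setT g by exact/measurable_EFinP.
have mp : measurable_fun setT g^\+%E by exact: measurable_funepos.
have mn : measurable_fun setT g^\-%E by exact: measurable_funeneg.
have lep : (\int[P]_w g^\+ w <= \int[P]_w (a w)%:E)%E.
  apply: ge0_le_integral => //.
  by move=> w _; rewrite /g funeposE /= ge_max !lee_fin a0 andbT lerBlDr lerDl.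
have len : (\int[P]_w g^\- w <= \int[P]_w (b w)%:E)%E.
  apply: ge0_le_integral => //.
  move=> w _; rewrite /g funenegE /= ge_max !lee_fin b0 andbT.
  by rewrite opprB lerBlDr lerDl.
split.
  by split=> //; case: ab => [h|h]; [left|right]; exact: le_lt_trans h.
have E : (\int[P]_w g^\+ w + \int[P]_w (b w)%:E =
          \int[P]_w g^\- w + \int[P]_w (a w)%:E)%E.
  rewrite -!ge0_integralD//; [|by move=> w _; rewrite lee_fin..].
  apply: eq_integral => w _; rewrite /g funeposE funenegE /= -!EFin_max -!EFinD.
  by congr EFin; rewrite /Num.max; case: ifPn; case: ifPn; lra.
have a1 : (0 <= \int[P]_w (a w)%:E)%E.
  by apply: integral_ge0 => w _; rewrite lee_fin.
have b1 : (0 <= \int[P]_w (b w)%:E)%E.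
  by apply: integral_ge0 => w _; rewrite lee_fin.
have p1 : (0 <= \int[P]_w g^\+ w)%E by exact: integral_ge0.
have n1 : (0 <= \int[P]_w g^\- w)%E by exact: integral_ge0.
rewrite -/g integralE; move: E ab lep len a1 b1 p1 n1.
move: (\int[P]_w g^\+ w)%E (\int[P]_w g^\- w)%E.
move: (\int[P]_w (a w)%:E)%E (\int[P]_w (b w)%:E)%E.
(* The two infinite cases that survive have A = B = +oo, which [ab] excludes; the finite case is
   linear. *)
move=> [A| |] [B| |] [p| |] [n| |] //=; last 2 first.
- by move=> _ [].
- by move=> _ [].
move=> [E] *; congr EFin; lra.
Qed.

(** * Integrals of functions of the random triple *)

Section joint_density.
Context {R : realType} {d K : nat} {X : set (d.-tuple R)}
  {disp : measure_display} {Omega : measurableType disp} {P : probability Omega R}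
  {x : Omega -> d.-tuple R} {y : Omega -> 'I_K} {s : Omega -> partial_label K}
  {p : @pll_density R d K} (mX : measurable X)
  (Hp : is_joint_density X P x y s p).

Let lambda := lebesgue_tuple R d.

(** The two labels form a single finite-valued map [z]; on each of its fibres [density_law] supplies
    the hypothesis of [ge0_integral_density]. *)
Lemma ge0_integral_joint_density (g : @pll_density R d K) :
  (forall j c, measurable_fun X (fun t => g t j c)) ->
  (forall t j c, X t -> 0 <= g t j c) ->
  (\int[P]_w (g (x w) (y w) (s w))%:E =
   \int[lambda]_(t in X) (\sum_c \sum_j g t j c * p t j c)%:E)%E.
Proof.
move=> mg g0.
have [mx my ms xX mp p0 law] := Hp.
pose z w := (y w, s w).
have zE j c : z @^-1` [set (j, c)] = y @^-1` [set j] `&` s @^-1` [set c].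
  by apply/seteqP; split=> [w [<- <-]|w [/= <- <-]].
have mz i : measurable (z @^-1` [set i]).
  by case: i => j c; rewrite zE; exact: measurableI.
have mgx i : measurable_fun (z @^-1` [set i])
    (fun w => (g (x w) i.1 i.2)%:E).
  apply/measurable_EFinP/measurable_funTS.
  apply: (measurable_comp mX _ (mg i.1 i.2) mx) => _ [w _ <-]; exact: xX.
rewrite (ge0_integral_fibers P z (fun i w => (g (x w) i.1 i.2)%:E))//;
  last first.
  by move=> w; rewrite lee_fin g0.
transitivity (\sum_(i : 'I_K * partial_label K)
    \int[lambda]_(t in X) (g t i.1 i.2 * p t i.1 i.2)%:E)%E.
  apply: eq_bigr => -[j c] _ /=.
  apply: (ge0_integral_density P lambda x _ X
    (p ^~ j ^~ c) (g ^~ j ^~ c)) => //.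
  - exact: measurable_funTS.
  - by move=> t Xt; exact: p0.
  - move=> A mA AX; rewrite -law//; congr (P _); rewrite zE.
    by apply/seteqP; split=> [w [[]]|w []].
  - by move=> t Xt; exact: g0.
rewrite -ge0_integral_sum//; last 2 first.
- by move=> i; apply/measurable_EFinP/measurable_funM.
- by move=> i t Xt; rewrite lee_fin mulr_ge0 ?g0 ?p0.
apply: eq_integral => t _.
by rewrite sumEFin exchange_big pair_bigA.
Qed.

(** * Sign and measurability of the weighted loss *)

Lemma density_xy_ge0 t j : X t -> 0 <= density_xy p t j.
Proof.
by move=> Xt; apply: sumr_ge0 => c _; exact: density_ge0 Hp _ _ _ Xt.
Qed.

Lemma density_x_ge0 t : X t -> 0 <= density_x p t.
Proof. by move=> Xt; apply: sumr_ge0 => j _; exact: density_xy_ge0. Qed.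

Lemma cond_y_x_ge0 t j : X t -> 0 <= cond_y_x p j t.
Proof. by move=> Xt; rewrite divr_ge0 ?density_xy_ge0 ?density_x_ge0. Qed.

Lemma measurable_cond_y_x j : measurable_fun X (cond_y_x p j).
Proof.
have mxy k : measurable_fun X (fun t => density_xy p t k).
  by apply: measurable_sum => c; exact: measurable_density Hp _ _.
by apply: measurable_funM => //; apply/measurable_funV/measurable_sum.
Qed.

Lemma weighted_loss_ge0 (f : d.-tuple R -> K.-tuple R)
    (L : K.-tuple R -> 'I_K -> R) t c :
  (forall v j, 0 <= L v j) -> X t -> 0 <= weighted_loss p f L t c.
Proof.
move=> L0 Xt; apply: sumr_ge0 => j _.
rewrite mulr_ge0// divr_ge0 ?cond_y_x_ge0//.
by apply: sumr_ge0 => k _; rewrite cond_y_x_ge0.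
Qed.

Lemma measurable_weighted_loss (f : d.-tuple R -> K.-tuple R)
    (L : K.-tuple R -> 'I_K -> R) c :
  measurable_fun X f -> (forall j, measurable_fun setT (L ^~ j)) ->
  measurable_fun X (fun t => weighted_loss p f L t c).
Proof.
move=> mf mL.
(* Sums restricted to the candidates become unconditional sums over a list, the form
   [measurable_sum] handles. *)
rewrite [X in measurable_fun _ X](_ : _ = fun t => \sum_(j <- enum (sval c))
    cond_y_x p j t / (\sum_(k <- enum (sval c)) cond_y_x p k t) * L (f t) j);
  last by apply/funext => t; rewrite /weighted_loss -!big_enum.
apply: measurable_sum => j; apply: measurable_funM.
  apply: measurable_funM; first exact: measurable_cond_y_x.
  by apply/measurable_funV/measurable_sum => k; exact: measurable_cond_y_x.
exact: (measurableT_comp (mL j)).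
Qed.

(* When the total mass of the candidates vanishes, so does every p(x, y = j)
   with j \in s, and the junk value of the weights is harmless. *)
Lemma sum_weighted_loss (f : d.-tuple R -> K.-tuple R)
    (L : K.-tuple R -> 'I_K -> R) t c (a : R) :
  X t -> (forall j, p t j c = a * (j \in sval c)%:R * density_xy p t j) ->
  \sum_j weighted_loss p f L t c * p t j c = \sum_j L (f t) j * p t j c.
Proof.
move=> Xt pE.
set S := \sum_(j in sval c) density_xy p t j.
(* Used twice: with the constant weighted loss, and with the loss itself. *)
have sumE (F : 'I_K -> R) : \sum_j F j * p t j c =
    a * \sum_(j in sval c) F j * density_xy p t j.
  rewrite [in RHS]big_mkcond mulr_sumr; apply: eq_bigr => j _.
  by rewrite pE; case: (j \in _); rewrite ?mulr1 ?mulr0 ?mul0r ?mulr0//; ring.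
rewrite !sumE -mulr_sumr -/S; congr (_ * _).
have [S0|S0] := eqVneq S 0.
  rewrite S0 mulr0 big1// => j jc.
  suff -> : density_xy p t j = 0 by rewrite mulr0.
  by move/eqP: S0; rewrite psumr_eq0 => [/allP/(_ j)|k _];
    [rewrite mem_index_enum jc => /(_ isT)/eqP|exact: density_xy_ge0].
(* If p(x) vanished, so would each p(x, j), and hence [S]. With both nonzero, the weights reduce to
   p(x, j) / S. *)
have px0 : density_x p t != 0.
  apply: contra_neq S0 => /eqP.
  rewrite psumr_eq0 => [/allP xy0|j _]; last exact: density_xy_ge0.
  by apply: big1 => j _; apply/eqP/(xy0 j); rewrite mem_index_enum.
rewrite /weighted_loss mulr_suml; apply: eq_bigr => j _.
rewrite /cond_y_x -mulr_suml -/S.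
by field; rewrite S0 px0.
Qed.

(** * Properness and nonnegative losses *)

(** Properness speaks only of labels with p(x, j) > 0. If p(x, j) = 0, nonnegativity forces every
    p(x, j, s) to vanish, so the product form extends to all labels. *)
Lemma proper_density : proper_pll X p ->
  {ae lambda, forall t, X t -> forall c, exists a, forall j,
    p t j c = a * (j \in sval c)%:R * density_xy p t j}.
Proof.
move=> [C]; apply: filterS => t HC Xt c; exists (C t c) => j.
have [xy0|xy0] := eqVneq (density_xy p t j) 0.
  rewrite xy0 mulr0; move/eqP: xy0.
  rewrite psumr_eq0 => [/allP/(_ c)|b _]; last exact: density_ge0 Hp _ _ _ Xt.
  by rewrite mem_index_enum => /(_ isT)/eqP.
rewrite -HC ?lt_def ?xy0 ?density_xy_ge0//.
by rewrite /cond_s_xy divfK.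
Qed.

(** Both integrands are treated as functions of the full triple. This puts the sums over labels
    under one integral in x, where they agree almost everywhere by [sum_weighted_loss]. *)
Lemma ge0_risk_proper (f : d.-tuple R -> K.-tuple R)
    (L : K.-tuple R -> 'I_K -> R) :
  proper_pll X p -> measurable_fun X f ->
  (forall j, measurable_fun setT (L ^~ j)) -> (forall v j, 0 <= L v j) ->
  (\int[P]_w (L (f (x w)) (y w))%:E =
   \int[P]_w (weighted_loss p f L (x w) (s w))%:E)%E.
Proof.
move=> prop mf mL L0.
have mp := measurable_density Hp; have p0 := density_ge0 Hp.
have mLf j : measurable_fun X (fun t => L (f t) j).
  exact: (measurableT_comp (mL j)).
have mW c := measurable_weighted_loss f L c mf mL.
rewrite (ge0_integral_joint_density (fun t j c => L (f t) j))//.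
rewrite (ge0_integral_joint_density
  (fun t j c => weighted_loss p f L t c))//; last first.
  by move=> t j c Xt; exact: weighted_loss_ge0.
apply: ge0_ae_eq_integral => //.
- apply/measurable_EFinP/measurable_sum => c; apply: measurable_sum => j.
  exact: measurable_funM.
- apply/measurable_EFinP/measurable_sum => c; apply: measurable_sum => j.
  exact: measurable_funM.
- move=> t Xt; rewrite lee_fin; apply: sumr_ge0 => c _; apply: sumr_ge0 => j _.
  by rewrite mulr_ge0 ?p0.
- move=> t Xt; rewrite lee_fin; apply: sumr_ge0 => c _; apply: sumr_ge0 => j _.
  by rewrite mulr_ge0 ?p0 ?weighted_loss_ge0.
apply: filterS (proper_density prop) => t pE Xt; congr EFin.
apply: eq_bigr => c _.
by have [a /(sum_weighted_loss f L _ _ _ Xt)->] := pE Xt c.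
Qed.

End joint_density.

(** * Signed losses *)

Theorem theorem3 (R : realType) (d K : nat) (HK : (2 < K)%N)
  (X : set (d.-tuple R)) (mX : measurable X)
  (disp : measure_display) (Omega : measurableType disp)
  (P : probability Omega R)
  (x : Omega -> d.-tuple R) (y : Omega -> 'I_K) (s : Omega -> partial_label K)
  (p : d.-tuple R -> 'I_K -> partial_label K -> R)
  (Hp : is_joint_density X P x y s p)
  (Hstd : candidate_contains_label X p)
  (Hproper : proper_pll X p)
  (f : d.-tuple R -> K.-tuple R) (mf : measurable_fun X f)
  (L : K.-tuple R -> 'I_K -> R)
  (mL : forall j : 'I_K, measurable_fun setT (fun v => L v j))
  (Hrisk : has_expectation P (fun w => L (f (x w)) (y w))) :
  has_expectation P (fun w => weighted_loss p f L (x w) (s w)) /\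
  classification_risk P x y f L =
    ('E_P[fun w => weighted_loss p f L (x w) (s w)])%E.
Proof.
have [mx _ ms xX _ _ _] := Hp.
pose Lp v j := Num.max (L v j) 0; pose Ln v j := Num.max (- L v j) 0.
have mLp j : measurable_fun setT (Lp ^~ j) by exact: measurable_funrpos.
have mLn j : measurable_fun setT (Ln ^~ j) by exact: measurable_funrneg.
have Lp0 v j : 0 <= Lp v j by rewrite le_max lexx orbT.
have Ln0 v j : 0 <= Ln v j by rewrite le_max lexx orbT.
(* The weights do not depend on the loss, so the weighted loss is linear in it. *)
have WE t c : weighted_loss p f L t c =
    weighted_loss p f Lp t c - weighted_loss p f Ln t c.
  rewrite /weighted_loss -sumrB; apply: eq_bigr => j _; rewrite -mulrBr.
  congr (_ * _); rewrite /Lp /Ln.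
  by rewrite -[LHS]/(L (f t) j) {1}(esym (funrposBneg (L (f t)))).
have posE : (\int[P]_w ((EFin \o (fun w => L (f (x w)) (y w)))^\+ w) =
    \int[P]_w (weighted_loss p f Lp (x w) (s w))%:E)%E.
  rewrite -(ge0_risk_proper mX Hp)//; apply: eq_integral => w _.
  by rewrite funeposE /= -EFin_max.
have negE : (\int[P]_w ((EFin \o (fun w => L (f (x w)) (y w)))^\- w) =
    \int[P]_w (weighted_loss p f Ln (x w) (s w))%:E)%E.
  rewrite -(ge0_risk_proper mX Hp)//; apply: eq_integral => w _.
  by rewrite funenegE /= -EFin_max.
(* For a fixed candidate set this is measurability in x; the random set is handled by gluing along
   the fibres of [s]. *)
have mW M : (forall j, measurable_fun setT (M ^~ j)) ->
    measurable_fun setT (fun w => weighted_loss p f M (x w) (s w)).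
  move=> mM; apply: (measurable_fun_fibers s
    (fun c w => weighted_loss p f M (x w) c)) => // c.
  apply/measurable_funTS; have mWc := measurable_weighted_loss Hp f M c mf mM.
  by apply: (measurable_comp mX _ mWc mx) => _ [w _ <-]; exact: xX.
have W0 M : (forall v j, 0 <= M v j) ->
    forall w, 0 <= weighted_loss p f M (x w) (s w).
  by move=> M0 w; exact: (weighted_loss_ge0 Hp).
(* Finiteness of one part of the risk passes to the matching weighted loss, which rules out +oo -
   +oo. *)
have [_ fin] := Hrisk; rewrite posE negE in fin.
have [hW EW] := integral_ge0B P _ _
  (mW _ mLp) (mW _ mLn) (W0 _ Lp0) (W0 _ Ln0) fin.
rewrite (_ : (fun w => weighted_loss p f L (x w) (s w)) = fun w =>
    weighted_loss p f Lp (x w) (s w) - weighted_loss p f Ln (x w) (s w));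
  last by apply/funext => w; exact: WE.
split=> //.
by rewrite /classification_risk !unlock EW integralE posE negE.
Qed.
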